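(* Let $S=[0,1)$ and let $\mathcal{B}$ be its Borel $\sigma$-field. Let $K^n(x,A)=\Pr[f^{(n)}(x,\xi^{(n)})\in A]$ for $n=1,2,\dots$, $x\in S$, $A\in\mathcal{B}$, where $f^{(n)}$ and $\xi^{(n)}$ are as defined in the context (random perturbations of the map $g(x)=x/2+17/30 \pmod 1$ by i.i.d. noise uniform on $[0,1/15]$). Then there exist a constant $C>0$, a constant $\rho<1$ and a measure $\mu$ on $(S,\mathcal{B})$ such that for all $n=1,2,\dots$, all $x\in S$ and all $A\in\mathcal{B}$, $$|K^n(x,A)-\mu(A)|\le C\rho^n .$$
   Context: $S=[0,1)$ carries the metric $\delta(x,y)=|x-y|$, and $\mathcal{B}$ is the Borel field it determines. For a real number $t$, $t \pmod 1$ denotes the representative in $[0,1)$. Let $g:S\to S$ be $g(x)=\tfrac12 x+\tfrac{17}{30}\pmod 1$. Let $\Omega=[0,2/30]=[0,1/15]$ and let $\Omega^n$ be its $n$-fold product, with generic element $\omega^n=(\omega_1,\dots,\omega_n)$. Define $f^{(n)}:S\times\Omega^n\to S$ recursively by $$f^{(1)}(x,\omega)=g(x)+\omega \pmod 1,\qquad f^{(n+1)}(x,\omega^{n+1})=f^{(1)}\bigl(f^{(n)}(x,\omega^n),\omega_{n+1}\bigr).$$ Let $\xi_1,\xi_2,\dots$ be independent random variables, each uniformly distributed on $\Omega$, and let $\xi^{(n)}=(\xi_1,\dots,\xi_n)$. *)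

(* Defs.v *)
From HB Require Import structures.
From mathcomp Require Import all_boot all_order all_algebra.
From mathcomp Require Import finmap.
From mathcomp Require Import all_classical all_reals all_analysis.

Set Implicit Arguments.
Unset Strict Implicit.
Unset Printing Implicit Defensive.

Import Order.TTheory GRing.Theory Num.Theory.
Import numFieldNormedType.Exports.

Local Open Scope classical_set_scope.
Local Open Scope ring_scope.

(* As sigma types over subsets of R, S01 and Omega carry the pseudometric that
   the library puts on subtypes, namely the restriction of |x - y|. *)
Definition S01 (R : realType) : Type := [set` `[0 : R, 1[].
HB.instance Definition _ (R : realType) := PseudoMetric.on (S01 R).

Definition Omega (R : realType) : Type := [set` `[0 : R, 2 / 30]].
HB.instance Definition _ (R : realType) := PseudoMetric.on (Omega R).

Lemma mod1_subproof (R : realType) (t : R) :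
  t - (Num.floor t)%:~R \in [set` `[0 : R, 1[].
Proof.
by rewrite inE /= in_itv /= subr_ge0 floor_le ltrBlDl -intrD1 floorD1_gt.
Qed.

Definition mod1 (R : realType) (t : R) : S01 R :=
  @exist R (fun x : R => x \in [set` `[0 : R, 1[]) _ (mod1_subproof t).

Lemma Omega0_subproof (R : realType) : (0 : R) \in [set` `[0 : R, 2 / 30]].
Proof. by rewrite inE /= in_itv /= lexx divr_ge0. Qed.

(* Measurable types are pointed in the library; the points play no role. *)
HB.instance Definition _ (R : realType) := isPointed.Build (S01 R) (mod1 0).
HB.instance Definition _ (R : realType) :=
  isPointed.Build (Omega R)
    (@exist R (fun x : R => x \in [set` `[0 : R, 2 / 30]]) _ (Omega0_subproof R)).

Definition borel (T : ptopologicalType) := g_sigma_algebraType (@open T).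
HB.instance Definition _ (T : ptopologicalType) := Measurable.on (borel T).

Definition gmap (R : realType) (x : S01 R) : S01 R :=
  mod1 (2^-1 * set_val x + 17 / 30).

Definition fstep (R : realType) (x : S01 R) (w : Omega R) : S01 R :=
  mod1 (set_val (gmap x) + set_val w).

(* Convention f^(0)(x) = x, so that f^(1)(x, w) is fstep x (w 0). *)
Fixpoint fn (R : realType) (n : nat) (x : S01 R) : ('I_n -> Omega R) -> S01 R :=
  match n return ('I_n -> Omega R) -> S01 R with
  | 0 => fun=> x
  | m.+1 => fun w =>
      fstep (fn x (fun i : 'I_m => w (widen_ord (leqnSn m) i))) (w ord_max)
  end.

Section random_variables.
Context (d : measure_display) (T : measurableType d) (R : realType)
  (P : probability T R).

Definition mutually_independent d' (T' : measurableType d')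
    (X : nat -> {RV P >-> T'}) : Prop :=
  forall (J : {fset nat}) (B : nat -> set T'),
    (forall i, i \in J -> measurable (B i)) ->
    P (\bigcap_(i in [set` J]) X i @^-1` B i) =
    (\prod_(i <- J) P (X i @^-1` B i))%E.

Lemma Omega_lt_subproof : (0 : R) < 2 / 30.
Proof. by rewrite divr_gt0. Qed.

Definition uniform_on_Omega (X : {RV P >-> borel (Omega R)}) : Prop :=
  forall B : set R, measurable B ->
    P [set t | B (set_val (X t : Omega R))] = uniform_prob Omega_lt_subproof B.

(* The variables are numbered from 0: xi 0 stands for xi_1. *)
Definition Kn (xi : nat -> {RV P >-> borel (Omega R)})
    (n : nat) (x : S01 R) (A : set (S01 R)) : \bar R :=
  P [set t | A (fn x (fun i : 'I_n => xi i t))].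

End random_variables.

(* Main.v *)
Require Import Defs.
From HB Require Import structures.
From mathcomp Require Import all_boot all_order all_algebra.
From mathcomp Require Import finmap.
From mathcomp Require Import all_classical all_reals all_analysis.
From mathcomp Require Import measurable_realfun ring lra.

(* Doeblin's method. The transition operator Q sends a test function h to
   (Q h)(x) = E[h(x/2 + 17/30 + noise mod 1)], and independence gives
   K^n(x, A) = (Q^n 1_A)(x). Since the noise has a density, Q h is at least a
   multiple of the integral of h over the interval J = [1, 1 + 1/240] (read
   modulo 1) at every point of an interval of starting points from which all of
   J can be reached in one step. Pulling that interval back through the
   expanding map y -> 2y - 34/30 while the noise widens it, twelve more steps
   cover the whole circle, which gives Q^13 h >= e * \int_J h everywhere. Applied to h - a
   and to b - h when a <= h <= b, this contracts the oscillation of h by the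
   factor 1 - e |J|. Hence Q^n 1_A(x) converges geometrically, uniformly in x
   and A, and a uniform limit of probability measures is a measure. *)

Set Implicit Arguments.
Unset Strict Implicit.
Unset Printing Implicit Defensive.

Import Order.TTheory GRing.Theory Num.Theory.
Import numFieldNormedType.Exports.

Local Open Scope classical_set_scope.
Local Open Scope ring_scope.

(** * Measurability and algebra of reduction modulo 1 *)

Lemma continuous_measurable_borel (R : realType) (T : ptopologicalType)
    (f : T -> R) :
  continuous f -> measurable_fun setT (f : borel T -> R).
Proof.
move=> /continuousP cf; apply: (measurability _ (RGenOpens.measurableE R)).
move=> _ [_ [a [b ->]] <-]; rewrite setTI; apply: sub_sigma_algebra.
exact/cf/interval_open.
Qed.

Lemma measurable_S01_val (R : realType) :
  measurable_fun setT (fun x : borel (S01 R) => set_val x).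
Proof.
apply: (@continuous_measurable_borel R (S01 R)) => x.
exact: (@initial_continuous (S01 R) R set_val).
Qed.

Lemma measurable_Omega_val (R : realType) :
  measurable_fun setT (fun w : borel (Omega R) => set_val w).
Proof.
apply: (@continuous_measurable_borel R (Omega R)) => w.
exact: (@initial_continuous (Omega R) R set_val).
Qed.

Lemma measurable_mod1 (R : realType) :
  measurable_fun setT (@mod1 R : R -> borel (S01 R)).
Proof.
apply: (@measurability _ _ R (borel (S01 R)) setT _ (@open (S01 R))) => //.
(* Open sets of the circle are traces of open sets [V] of the line, so it is enough to treat the
   real function [t - floor t], a difference of monotone functions. *)
move=> _ [_ [V oV <-] <-]; rewrite setTI.
have mfrac : measurable_fun setT (fun t : R => t - (Num.floor t)%:~R).
  apply: measurable_funB => //; apply: nondecreasing_measurable => // x y xy.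
  by rewrite ler_int le_floor.
rewrite -[X in measurable X]setTI.
by apply: mfrac => //; exact: open_measurable.
Qed.

Lemma mod1Dz (R : realType) (t : R) (k : int) : mod1 (t + k%:~R) = mod1 t.
Proof.
by apply/val_inj => /=; rewrite floorDrz ?intr_int// intrKfloor intrD; lra.
Qed.

Lemma S01_valP (R : realType) (x : S01 R) : 0 <= set_val x < 1.
Proof. by have := valP x; rewrite inE /= in_itv. Qed.

Lemma mod1_set_val (R : realType) (x : S01 R) : mod1 (set_val x) = x.
Proof.
by apply/val_inj => /=; rewrite (floor_def (m := 0)) ?subr0// add0r S01_valP.
Qed.

Lemma mod1_id (R : realType) (t : R) : 0 <= t < 1 -> set_val (mod1 t) = t.
Proof.
by move=> t01; rewrite set_valE /= (floor_def (m := 0)) ?subr0// add0r.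
Qed.

(** The inner reduction shifts the sum by an integer, which the outer one absorbs; the two
    reductions in [fstep] thus collapse into one. *)
Lemma mod1Dl (R : realType) (s t : R) :
  mod1 (set_val (mod1 s) + t) = mod1 (s + t).
Proof. by rewrite set_valE /= addrAC -mulrNz mod1Dz. Qed.

Lemma fstepE (R : realType) (x : S01 R) (w : Omega R) :
  fstep x w = mod1 (2^-1 * set_val x + 17 / 30 + set_val w).
Proof. exact: mod1Dl. Qed.

(** * Test functions and the transition operator *)

Definition test_fun (R : realType) (h : S01 R -> R) : Prop :=
  measurable_fun setT (h : borel (S01 R) -> R) /\ forall x, 0 <= h x <= 1.

Lemma test_fun_ge0 (R : realType) (h : S01 R -> R) (x : S01 R) :
  test_fun h -> 0 <= h x.
Proof. by case=> _ /(_ x)/andP[]. Qed.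

Lemma test_fun_le1 (R : realType) (h : S01 R -> R) (x : S01 R) :
  test_fun h -> h x <= 1.
Proof. by case=> _ /(_ x)/andP[]. Qed.

Local Notation noise R := (uniform_prob (Omega_lt_subproof R)).

(** The law of the noise is taken on the real line instead of [Omega], where it has a Lebesgue
    density. *)
Definition transition (R : realType) (h : S01 R -> R) (x : S01 R) : R :=
  \int[noise R]_w h (mod1 (2^-1 * set_val x + 17 / 30 + w)).

Lemma measurable_mod1D (R : realType) (h : S01 R -> R) (s : R) :
  measurable_fun setT (h : borel (S01 R) -> R) ->
  measurable_fun setT (fun w : R => h (mod1 (s + w))).
Proof.
move=> mh.
have ms : measurable_fun setT (fun w : R => mod1 (s + w) : borel (S01 R)).
  by apply: (measurableT_comp (@measurable_mod1 R)); exact: measurable_funD.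
exact: (measurableT_comp mh ms).
Qed.

Lemma measurable_step (R : realType) :
  measurable_fun setT
    (fun z : borel (S01 R) * R => mod1 (2^-1 * set_val z.1 + 17 / 30 + z.2)
      : borel (S01 R)).
Proof.
apply: (measurableT_comp (@measurable_mod1 R)).
apply: measurable_funD; last exact: measurable_snd.
apply: measurable_funD => //; apply: measurable_funM => //.
exact: (measurableT_comp (@measurable_S01_val R) measurable_fst).
Qed.

Lemma integrable_bounded (d : measure_display) (T : measurableType d)
    (R : realType) (P : probability T R) (f : T -> R) (M : R) :
  measurable_fun setT f -> (forall x, `|f x| <= M) ->
  P.-integrable setT (EFin \o f).
Proof.
move=> mf fM; apply: measurable_bounded_integrable => //.
  by rewrite -ge0_fin_numE// fin_num_measure.
exists M; split; first exact: num_real.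
by move=> x Mx y _; exact: le_trans (ltW Mx).
Qed.

Lemma integrable_mod1D (R : realType) (h : S01 R -> R) (s : R) :
  test_fun h -> (noise R).-integrable setT (fun w => (h (mod1 (s + w)))%:E).
Proof.
move=> th; apply: (@integrable_bounded _ _ _ _ _ 1).
  by apply: measurable_mod1D; case: th.
by move=> w; rewrite ger0_norm ?test_fun_ge0// test_fun_le1.
Qed.

Lemma transition_cst (R : realType) (c : R) (x : S01 R) :
  transition (fun=> c) x = c.
Proof.
rewrite /transition Rintegral_cst//.
by rewrite [X in fine X](@probability_setT _ _ _ (noise R)) mulr1.
Qed.

Lemma transition_bounds (R : realType) (h : S01 R -> R) (a b : R) :
  test_fun h -> (forall y, a <= h y <= b) ->
  forall x, a <= transition h x <= b.
Proof.
move=> th hab x; 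
have cstI (c : R) := @finite_measure_integrable_cst _ _ _ (noise R) setT c.
have hI := integrable_mod1D (2^-1 * set_val x + 17 / 30) th.
have ha y : a <= h y by case/andP: (hab y).
have hb y : h y <= b by case/andP: (hab y).
apply/andP; split.
  rewrite -[leLHS](transition_cst a x).
  by apply: le_Rintegral => //; exact: cstI.
rewrite -[leRHS](transition_cst b x).
by apply: le_Rintegral => //; exact: cstI.
Qed.

Lemma transition_affine (R : realType) (h : S01 R -> R) (a c : R) :
  test_fun h ->
  transition (fun y => a + c * h y) = (fun x => a + c * transition h x).
Proof.
move=> th; apply/funext => x; rewrite /transition.
have hI := integrable_mod1D (2^-1 * set_val x + 17 / 30) th.
rewrite RintegralD//; last 2 first.
- exact: (@finite_measure_integrable_cst _ _ _ (noise R) setT a).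
- exact: (integrableZl measurableT c hI).
by congr (_ + _); [exact: (transition_cst a x)|rewrite RintegralZl].
Qed.

Lemma test_fun_transition (R : realType) (h : S01 R -> R) :
  test_fun h -> test_fun (transition h).
Proof.
move=> th; split; last by move=> x; apply: transition_bounds => //; case: th.
have [mh _] := th.
(* Measurability in the starting point is that of a partial integral of a jointly measurable
   nonnegative function. *)
apply: (measurableT_comp (fine_measurable measurableT)) => //.
apply: (@measurable_fun_fubini_tonelli_F _ _ (borel (S01 R))
  (measurableTypeR R) R (noise R)
  (fun z => (h (mod1 (2^-1 * set_val z.1 + 17 / 30 + z.2)))%:E)).
  by apply/measurable_EFinP; exact: (measurableT_comp mh (@measurable_step R)).
by move=> z; rewrite lee_fin test_fun_ge0.
Qed.

Lemma test_fun_iter (R : realType) (h : S01 R -> R) (n : nat) :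
  test_fun h -> test_fun (iter n (@transition R) h).
Proof. by move=> th; elim: n => //= n; exact: test_fun_transition. Qed.

(** With [c] equal to 1 or -1 this carries lower bounds for [h - a] and [b - h] back to two-sided
    bounds for [h]. *)
Lemma iter_transition_affine (R : realType) (h : S01 R -> R) (a c : R)
    (n : nat) :
  test_fun h -> iter n (@transition R) (fun y => a + c * h y) =
                (fun x => a + c * iter n (@transition R) h x).
Proof.
move=> th; elim: n => //= n ->.
by rewrite transition_affine//; exact: test_fun_iter.
Qed.

Lemma iter_transition_bounds (R : realType) (h : S01 R -> R) (a b : R)
    (n : nat) :
  test_fun h -> (forall y, a <= h y <= b) ->
  forall x, a <= iter n (@transition R) h x <= b.
Proof.
move=> th hab; elim: n => //= n.
by apply: transition_bounds; exact: test_fun_iter.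
Qed.

Lemma test_fun_indic (R : realType) (A : set (borel (S01 R))) :
  measurable A -> test_fun (\1_A : S01 R -> R).
Proof.
move=> mA; split=> // x; rewrite indicE.
by case: (_ \in _); rewrite ?lexx ?ler01.
Qed.

(** * Translation invariance and the density of the noise *)

Lemma lebesgue_measureDl (R : realType) (s : R) (A : set R) : measurable A ->
  lebesgue_measure A =
  pushforward lebesgue_measure (fun w => s + w : measurableTypeR R) A.
Proof.
have ms : measurable_fun setT (fun w : R => s + w) by exact: measurable_funD.
pose nu : {measure set (measurableTypeR R) -> \bar R} :=
  pushforward lebesgue_measure (fun w : R => s + w : measurableTypeR R).
(* Half-open intervals determine the measure, and a shift preserves their length. *)
apply: (lebesgue_measure_unique (mu := nu ms)) => _ [[a b]] _ <-.
rewrite /nu /= /pushforward /= (_ : _ @^-1` _ = `]a - s, b - s]%classic).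
  rewrite !lebesgue_measure_itv/= !lte_fin ltrD2r.
  by case: ifPn => // _; rewrite -!EFinB; congr EFin; lra.
by apply/seteqP; split => x /=; rewrite !in_itv /=; lra.
Qed.

Lemma ge0_integralDl (R : realType) (f : R -> \bar R) (s : R) (D : set R) :
  measurable D -> measurable_fun D f -> {in D, forall u, (0 <= f u)%E} ->
  (\int[lebesgue_measure]_(w in [set w | D (s + w)%R]) f (s + w)%R =
  \int[lebesgue_measure]_(u in D) f u)%E.
Proof.
move=> mD mf f0.
have ms : measurable_fun setT (fun w : R => s + w : measurableTypeR R).
  exact: measurable_funD.
have := @ge0_integral_pushforward _ _ (measurableTypeR R)
  (measurableTypeR R) R (fun w => s + w) ms lebesgue_measure D f mD mf f0.
rewrite /comp => <-; apply/esym/eq_measure_integral => A mA _.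
exact: lebesgue_measureDl.
Qed.

(** The density 15 is the inverse of the length 2 / 30 of [Omega]. *)
Lemma integral_noise (R : realType) (f : R -> \bar R) :
  measurable_fun setT f -> (forall w, (0 <= f w)%E) ->
  (\int[noise R]_w f w =
   15%:E * \int[lebesgue_measure]_(w in `[0%R, (2 / 30)%R]) f w)%E.
Proof.
move=> mf f0; rewrite (integral_uniform (Omega_lt_subproof R) mf f0).
by congr (_%:E * _)%E; field.
Qed.

Lemma noise_itv (R : realType) (e l : R) :
  0 <= e -> 0 <= l -> e + l <= 2 / 30 ->
  noise R `[e, e + l]%classic = (15 * l)%:E.
Proof.
move=> e0 l0 el.
transitivity (\int[noise R]_w (\1_(`[e, e + l]%classic) w)%:E)%E.
  by rewrite integral_indic// setIT.
rewrite integral_noise//; last first.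
  exact/measurable_EFinP/measurable_indic.
rewrite integral_indic// (_ : _ `&` _ = `[e, e + l]%classic); last first.
  by apply/seteqP; split => x /=; rewrite !in_itv /=; lra.
rewrite [X in (_ * X)%E](_ : _ =
  lebesgue_measure (`[e, e + l]%classic : set R))//.
rewrite lebesgue_measure_itv/= lte_fin; case: ifPn => el'.
  by rewrite -EFinB -EFinM; congr EFin; lra.
by rewrite mule0; congr EFin; lra.
Qed.

(** * Minorization of the thirteenth iterate *)

Lemma transition_ge_integral (R : realType) (h : S01 R -> R) (c d y : R) :
  test_fun h -> 0 <= y < 1 ->
  2 * d - 38 / 30 <= y <= 2 * c - 34 / 30 ->
  15 * \int[lebesgue_measure]_(u in `[c, d]) h (mod1 u) <= transition h (mod1 y).
Proof.
move=> th y01 ycd; rewrite /transition mod1_id//.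
set s := 2^-1 * y + 17 / 30; have [mh _] := th.
have mhs : measurable_fun setT (fun w : R => h (mod1 w)).
  exact: (measurableT_comp mh (@measurable_mod1 R)).
have h0 w : (0 <= (h w)%:E)%E by rewrite lee_fin test_fun_ge0.
have hJ : lebesgue_measure.-integrable `[c, d]%classic
    (EFin \o (fun u => h (mod1 u))).
  apply: measurable_bounded_integrable => //.
  - rewrite [ltLHS](_ : _ = lebesgue_measure (`[c, d]%classic : set R))//.
    by rewrite lebesgue_measure_itv/=; case: ifPn => // _; rewrite ltry.
  - exact: measurable_funTS.
  - exists 1; split; first exact: num_real.
    move=> M M1 w _; rewrite /= ger0_norm ?test_fun_ge0//.
    by apply: le_trans (ltW M1); exact: test_fun_le1.
rewrite -lee_fin EFinM fineK ?(integrable_fin_num _ hJ)//.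
rewrite fineK; last first.
  by apply: integrable_fin_num => //; exact: integrable_mod1D.
rewrite integral_noise; last 2 first.
- by apply/measurable_EFinP; exact: measurable_mod1D.
- by move=> w; exact: h0.
apply: lee_wpmul2l; first by rewrite lee_fin.
(* The bounds on [y] put [c, d] inside the window [[s, s + 2 / 30]], and enlarging the domain of a
   nonnegative integrand can only increase the integral. *)
rewrite [X in (_ <= X)%E](_ : _ =
    \int[lebesgue_measure]_(u in `[s, (s + 2 / 30)%R]) (h (mod1 u))%:E)%E.
  apply: ge0_subset_integral => //.
    by apply/measurable_EFinP; exact: measurable_funTS.
  by move=> u /=; rewrite !in_itv /= /s; lra.
rewrite -(@ge0_integralDl R (fun u => (h (mod1 u))%:E) s
  `[s, s + 2 / 30]%classic)//.
  congr integral; apply/seteqP; split => w /=; rewrite !in_itv /=; lra.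
by apply/measurable_EFinP; exact: measurable_funTS.
Qed.

(* The bounds on [y] say that the window [y / 2 + 17 / 30, y / 2 + 19 / 30] of
   possible values before reduction meets [c, d] in length at least [l]. *)
Lemma transition_spread (R : realType) (h : S01 R -> R) (c d l k y : R) :
  test_fun h -> 0 <= k -> 0 <= l -> l <= 2 / 30 -> l <= d - c ->
  (forall u, c <= u <= d -> k <= h (mod1 u)) ->
  0 <= y < 1 -> 2 * (c + l) - 38 / 30 <= y <= 2 * (d - l) - 34 / 30 ->
  15 * l * k <= transition h (mod1 y).
Proof.
move=> th k0 l0 l2 lcd hk y01 ycd; rewrite /transition mod1_id//.
set s := 2^-1 * y + 17 / 30.
(* The noises in [e, e + l] all send [s] into [c, d]; [e] is the larger of 0 and [c - s]. *)
have [e [e0 ce el sel]] : exists e, [/\ 0 <= e, c <= s + e, e + l <= 2 / 30 &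
    s + (e + l) <= d].
  by have [cs|cs] := leP c s; [exists 0|exists (c - s)]; split;
    rewrite /s in cs *; lra.
have mI : measurable `[e, e + l]%classic by [].
rewrite (_ : 15 * l * k = \int[noise R]_w (k * \1_(`[e, e + l]%classic) w)).
  apply: le_Rintegral => //; last 2 first.
  - exact: integrable_mod1D.
  - move=> w _; rewrite indicE; case: (boolP (_ \in _)) => [|_].
      by rewrite inE /= in_itv /= mulr1 => ewl; apply: hk; lra.
    by rewrite mulr0 test_fun_ge0.
  exact: (integrableZl measurableT k (integrable_indic (noise R) mI)).
rewrite RintegralZl//; last first.
  exact: integrable_indic.
rewrite /Rintegral integral_indic// setIT.
by rewrite [X in fine X](noise_itv e0 l0 el) mulrC.
Qed.

(** The endpoints are real numbers read modulo 1, so that an arc through 0 is still a single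
    interval. *)
Definition lower_on (R : realType) (h : S01 R -> R) (c d k : R) : Prop :=
  forall u, c <= u <= d -> k <= h (mod1 u).

(* [z] brings [u] back to [0, 1) and [i] moves [c, d] by full turns. *)
Lemma lower_on_transition (R : realType) (h : S01 R -> R) (c d l k c' d' : R) :
  test_fun h -> 0 <= k -> 0 <= l <= 2 / 30 -> l <= d - c -> lower_on h c d k ->
  (forall u, c' <= u <= d' -> exists z i : int,
    0 <= u + z%:~R < 1 /\
    2 * (c + i%:~R + l) - 38 / 30 <= u + z%:~R <=
    2 * (d + i%:~R - l) - 34 / 30) ->
  lower_on (transition h) c' d' (15 * l * k).
Proof.
move=> th k0 /andP[l0 l1] lcd hk cd u /cd[z [i [u01 ui]]].
rewrite -(mod1Dz u z).
apply: (transition_spread (c := c + i%:~R) (d := d + i%:~R)) => //; first lra.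
by move=> v vcd; rewrite -(subrK i%:~R v) mod1Dz; apply: hk; lra.
Qed.

Lemma transition_minorized (R : realType) : exists2 e : R, 0 < e &
  forall h : S01 R -> R, test_fun h -> forall x,
    e * \int[lebesgue_measure]_(u in `[1, 1 + 1 / 240]) h (mod1 u) <=
    iter 13 (@transition R) h x.
Proof.
(* Each step doubles the distance of the interval to its limiting position and
   adds [2 * l] to it, so this [l] leaves room for twelve steps. *)
have [l [l0 l4096 l01]] : exists l : R,
    [/\ 0 < l, 4096 * l <= 1 / 30 & 0 <= l <= 2 / 30].
  by exists (1 / 30 / 4096); split; lra.
(* The first step contributes the density 15, each of the twelve others a factor [15 * l]. *)
exists ((15 * l) ^+ 12 * 15); first by rewrite mulr_gt0// exprn_gt0//; lra.
move=> h th x; set N := Rintegral _ _ _.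
have N0 : 0 <= N.
  by apply: Rintegral_ge0 => u _; exact: test_fun_ge0.
have t n : test_fun (iter n (@transition R) h) by exact: test_fun_iter.
have k0 n : 0 <= (15 * l) ^+ n * (15 * N).
  by rewrite mulr_ge0 ?exprn_ge0// ?mulr_ge0//; case/andP: l01.
have L n c d c' d' : l <= d - c ->
    lower_on (iter n.+1 (@transition R) h) c d ((15 * l) ^+ n * (15 * N)) ->
    (forall u, c' <= u <= d' -> exists z i : int,
      0 <= u + z%:~R < 1 /\
      2 * (c + i%:~R + l) - 38 / 30 <= u + z%:~R <=
      2 * (d + i%:~R - l) - 34 / 30) ->
    lower_on (iter n.+2 (@transition R) h) c' d' ((15 * l) ^+ n.+1 * (15 * N)).
  by move=> lcd hk cd; rewrite exprS -mulrA; exact: lower_on_transition hk cd.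
(* All of J is within reach exactly from [2 * (1 + 1 / 240) - 38 / 30], which is 89 / 120, up to
   [2 * 1 - 34 / 30]. *)
have low : lower_on (iter 1 (@transition R) h) (89 / 120) (26 / 30)
    ((15 * l) ^+ 0 * (15 * N)).
  move=> u ucd; rewrite expr0 mul1r; apply: transition_ge_integral => //; lra.
(* Modulo full turns, a step sends a lower end [c] to [2 * c - 38 / 30] and an upper end [d] to
   [2 * d - 34 / 30], up to [2 * l]. Lower ends are rounded up to absorb that loss, or cut at 0.
   Upper ends follow the 4-cycle 26/30, 18/30, 2/30, 1 modulo 1, with a loss that doubles and grows
   by [2 * l]. *)
have {}low : lower_on (iter 2 (@transition R) h) (7 / 30) (18 / 30 - 2 * l)
    ((15 * l) ^+ 1 * (15 * N)).
  apply: (L _ _ _ _ _ _ low) => {L k0 low}; first lra.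
  by move=> u ucd; exists 0, 0; lra.
have {}low : lower_on (iter 3 (@transition R) h) 0 (2 / 30 - 6 * l)
    ((15 * l) ^+ 2 * (15 * N)).
  apply: (L _ _ _ _ _ _ low) => {L k0 low}; first lra.
  by move=> u ucd; exists 0, 0; lra.
have {}low : lower_on (iter 4 (@transition R) h) (225 / 300) (1 - 14 * l)
    ((15 * l) ^+ 3 * (15 * N)).
  apply: (L _ _ _ _ _ _ low) => {L k0 low}; first lra.
  by move=> u ucd; exists 0, 1; lra.
have {}low : lower_on (iter 5 (@transition R) h) (8 / 30) (26 / 30 - 30 * l)
    ((15 * l) ^+ 4 * (15 * N)).
  apply: (L _ _ _ _ _ _ low) => {L k0 low}; first lra.
  by move=> u ucd; exists 0, 0; lra.
have {}low : lower_on (iter 6 (@transition R) h) 0 (18 / 30 - 62 * l)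
    ((15 * l) ^+ 5 * (15 * N)).
  apply: (L _ _ _ _ _ _ low) => {L k0 low}; first lra.
  by move=> u ucd; exists 0, 0; lra.
(* From here on an interval may cross an integer; its two sides use different turns, hence the case
   splits. *)
have {}low : lower_on (iter 7 (@transition R) h) (225 / 300) (32 / 30 - 126 * l)
    ((15 * l) ^+ 6 * (15 * N)).
  apply: (L _ _ _ _ _ _ low) => {L k0 low}; first lra.
  by move=> u ucd; have [u1|u1] := ltP u 1; [exists 0, 1|exists (-1), 0]; lra.
have {}low : lower_on (iter 8 (@transition R) h) (8 / 30) (1 - 254 * l)
    ((15 * l) ^+ 7 * (15 * N)).
  apply: (L _ _ _ _ _ _ low) => {L k0 low}; first lra.
  by move=> u ucd; exists 0, 0; lra.
have {}low : lower_on (iter 9 (@transition R) h) 0 (26 / 30 - 510 * l)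
    ((15 * l) ^+ 8 * (15 * N)).
  apply: (L _ _ _ _ _ _ low) => {L k0 low}; first lra.
  by move=> u ucd; exists 0, 0; lra.
have {}low : lower_on (iter 10 (@transition R) h) (- (75 / 300))
    (18 / 30 - 1022 * l) ((15 * l) ^+ 9 * (15 * N)).
  apply: (L _ _ _ _ _ _ low) => {L k0 low}; first lra.
  by move=> u ucd; have [u1|u1] := ltP u 0; [exists 1, 1|exists 0, 0]; lra.
have {}low : lower_on (iter 11 (@transition R) h) (8 / 30) (32 / 30 - 2046 * l)
    ((15 * l) ^+ 10 * (15 * N)).
  apply: (L _ _ _ _ _ _ low) => {L k0 low}; first lra.
  by move=> u ucd; have [u1|u1] := ltP u 1; [exists 0, 1|exists (-1), 0]; lra.
have {}low : lower_on (iter 12 (@transition R) h) 0 (1 - 4094 * l)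
    ((15 * l) ^+ 11 * (15 * N)).
  apply: (L _ _ _ _ _ _ low) => {L k0 low}; first lra.
  by move=> u ucd; exists 0, 0; lra.
have /(_ (set_val x)) : lower_on (iter 13 (@transition R) h) (set_val x)
    (set_val x) ((15 * l) ^+ 12 * (15 * N)).
  apply: (L _ _ _ _ _ _ low) => {L k0 low}; first lra.
  move=> u ucd; have := S01_valP x; have -> : set_val x = u by lra.
  (* The starting points served without and with a full turn are [[0, 26/30 - 8190 * l]] and
     [[22/30 + 2 * l, 1)]. They cover the circle, and 23 / 30 lies in both. *)
  by move=> u01; have [u1|u1] := leP u (23 / 30); [exists 0, 0|exists 0, 1]; lra.
by rewrite lexx mod1_set_val mulrA; apply.
Qed.

(** * Contraction of the oscillation and the geometric rate *)

Lemma bernoulli_le (R : realDomainType) (e : R) (n : nat) :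
  0 <= e <= 1 -> 1 - n%:R * e <= (1 - e) ^+ n.
Proof.
move=> e01; elim: n => [|n IH]; first by rewrite mul0r subr0 expr0.
have n0 : 0 <= n%:R :> R by [].
rewrite exprS; apply: (@le_trans _ _ ((1 - e) * (1 - n%:R * e))).
  by rewrite -natr1; nra.
by apply: ler_wpM2l => //; lra.
Qed.

Lemma Rintegral_affine (R : realType) (h : S01 R -> R) (a c : R) : test_fun h ->
  \int[lebesgue_measure]_(u in `[1, 1 + 1 / 240]) (a + c * h (mod1 u)) =
  a / 240 + c * \int[lebesgue_measure]_(u in `[1, 1 + 1 / 240]) h (mod1 u).
Proof.
move=> [mh h01].
have J240 : lebesgue_measure (`[1, 1 + 1 / 240]%classic : set R) = (1 / 240)%:E.
  rewrite lebesgue_measure_itv/= lte_fin ifT; last lra.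
  by rewrite -[LHS]/((1 + 1 / 240 - 1)%:E); apply: (congr1 EFin); lra.
have bI (f : R -> R) M : measurable_fun setT f -> (forall u : R, `|f u| <= M) ->
    lebesgue_measure.-integrable `[1, 1 + 1 / 240]%classic (EFin \o f).
  move=> mf fM; apply: measurable_bounded_integrable => //.
  - by rewrite [ltLHS]J240 ltry.
  - exact: measurable_funTS.
  - exists M; split; first exact: num_real.
    by move=> M' MM' u _; exact: le_trans (ltW MM').
have hI : lebesgue_measure.-integrable `[1, 1 + 1 / 240]%classic
    (EFin \o (fun u => h (mod1 u))).
  apply: (@bI _ 1); first exact: (measurableT_comp mh (@measurable_mod1 R)).
  by move=> u; have /andP[h0 h1] := h01 (mod1 u); rewrite ger0_norm.
rewrite RintegralD//; last 2 first.
- by apply: (@bI _ `|a|) => //.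
- exact: (integrableZl _ c hI).
rewrite Rintegral_cst// RintegralZl//; congr (_ + _).
by rewrite [X in fine X]J240 /=; lra.
Qed.

Lemma test_fun_affine (R : realType) (h : S01 R -> R) (a c : R) :
  test_fun h -> (forall y, 0 <= a + c * h y <= 1) ->
  test_fun (fun y => a + c * h y).
Proof.
move=> [mh _] b; split=> //.
by apply: measurable_funD => //; apply: measurable_funM.
Qed.

Lemma transition_contraction (R : realType) : exists2 e : R, 0 < e <= 1 &
  forall (h : S01 R -> R) (a b : R), test_fun h -> 0 <= a -> b <= 1 ->
  (forall y, a <= h y <= b) ->
  exists a' b', [/\ 0 <= a', b' <= 1, b' - a' = (1 - e) * (b - a) &
                 forall x, a' <= iter 13 (@transition R) h x <= b'].
Proof.
have [e e0 minor] := transition_minorized R.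
have key h a b : test_fun h -> 0 <= a -> b <= 1 -> (forall y, a <= h y <= b) ->
    exists a' b', [/\ 0 <= a', b' <= 1, b' - a' = (1 - e / 240) * (b - a) &
                 forall x, a' <= iter 13 (@transition R) h x <= b'].
  move=> th a0 b1 hab.
  set N := \int[lebesgue_measure]_(u in `[1, 1 + 1 / 240]) h (mod1 u).
  have t1 : test_fun (fun y => - a + 1 * h y).
    by apply: test_fun_affine => // y; have := hab y; lra.
  have t2 : test_fun (fun y => b + (-1) * h y).
    by apply: test_fun_affine => // y; have := hab y; lra.
  have I1 := Rintegral_affine (- a) 1 th.
  have I2 := Rintegral_affine b (-1) th.
  rewrite -/N in I1 I2.
  have N1 : 0 <= - a / 240 + 1 * N.
    by rewrite -I1; apply: Rintegral_ge0 => u _; exact: (test_fun_ge0 _ t1).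
  have N2 : 0 <= b / 240 + (-1) * N.
    by rewrite -I2; apply: Rintegral_ge0 => u _; exact: (test_fun_ge0 _ t2).
  (* The bounds move inwards by [e] times the integrals of [h - a] and [b - h] over J. These
     integrals add up to [(b - a) / 240], whatever [h] is. *)
  exists (a + e * (- a / 240 + 1 * N)), (b - e * (b / 240 + (-1) * N)); split.
  - exact: (addr_ge0 a0 (mulr_ge0 (ltW e0) N1)).
  - by rewrite (le_trans _ b1)// gerBl mulr_ge0// ltW.
  - by field.
  move=> x; apply/andP; split.
    by have := minor _ t1 x; rewrite I1 iter_transition_affine//; lra.
  by have := minor _ t2 x; rewrite I2 iter_transition_affine//; lra.
exists (e / 240); last exact: key.
apply/andP; split; first lra.
(* That [e / 240 <= 1] comes from [key] itself: for the zero function between 0 and 1 the new gap is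
   [1 - e / 240], and it encloses a value. *)
have tc : test_fun (fun=> 0 : R).
  by split=> // x; rewrite lexx ler01.
have [|a [b [_ _ ba ab]]] := @key (fun=> 0) 0 1 tc (lexx 0) (lexx 1).
  by move=> y; rewrite lexx ler01.
by have := ab (mod1 0); lra.
Qed.

(** Later iterates are averages of earlier ones and keep their bounds, so one oscillation estimate
    compares different times as well as different starting points. *)
Lemma transition_ergodic (R : realType) : exists C rho : R,
  [/\ 0 < C, 0 <= rho, rho < 1 &
      forall (h : S01 R -> R), test_fun h -> forall (n j : nat) (x y : S01 R),
        (n <= j)%N ->
        `|iter n (@transition R) h x - iter j (@transition R) h y| <=
        C * rho ^+ n].
Proof.
have [e /andP[e0 e1] contr] := transition_contraction R.
(* By Bernoulli's inequality this rational expression can replace the 13th root of [1 - e]. *)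
pose rho := 1 - e / 13.
have rho0 : 0 < rho by rewrite /rho; lra.
have rho1 : rho < 1 by rewrite /rho; lra.
have rho13 : 1 - e <= rho ^+ 13.
  have -> : 1 - e = 1 - 13%:R * (e / 13) by field.
  by apply: bernoulli_le; lra.
(* The factor [rho ^- 13] pays for rounding [n] down to a multiple of 13. *)
exists (rho ^- 13), rho.
split; [by rewrite invr_gt0 exprn_gt0|exact: ltW|by []|].
move=> h th n j x y nj; set q := (n %/ 13)%N.
have [a [b [a0 b1 ba hab]]] : exists a b,
    [/\ 0 <= a, b <= 1, b - a = (1 - e) ^+ q &
    forall x, a <= iter (q * 13) (@transition R) h x <= b].
  elim: q => [|q [a [b [a0 b1 ba hab]]]].
    exists 0, 1; split; rewrite ?lexx ?expr0 ?subr0//.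
    by case: th.
  have [a' [b' [a'0 b'1 ba' hab']]] :=
    contr _ _ _ (test_fun_iter _ th) a0 b1 hab.
  by exists a', b'; split; rewrite // ?ba' ?ba ?exprS.
have in_ab m z : (n <= m)%N -> a <= iter m (@transition R) h z <= b.
  move=> nm; rewrite -(@subnK (q * 13) m); last first.
    by apply: leq_trans nm; exact: leq_divM.
  by rewrite iterD; apply: iter_transition_bounds => //; exact: test_fun_iter.
apply: (@le_trans _ _ ((1 - e) ^+ q)).
  rewrite -ba ler_norml.
  by have := in_ab n x (leqnn n); have := in_ab j y nj; lra.
rewrite ler_pdivlMl ?exprn_gt0//.
apply: (@le_trans _ _ (rho ^+ 13 * rho ^+ (13 * q))).
  rewrite ler_pM2l ?exprn_gt0// exprM.
  by apply: lerXn2r; rewrite ?nnegrE ?subr_ge0// exprn_ge0// ltW.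
rewrite -exprD; apply: ler_wiXn2l; [exact: ltW|exact: ltW|].
by rewrite -mulnS mulnC ltnW// ltn_ceil.
Qed.

(** * Independence and the law of the chain *)

Lemma integral_independent (d d1 d2 : measure_display) (T : measurableType d)
    (T1 : measurableType d1) (T2 : measurableType d2) (R : realType)
    (Q : {finite_measure set T -> \bar R})
    (nu : {sigma_finite_measure set T2 -> \bar R})
    (X : T -> T1) (Y : T -> T2) (f : T1 * T2 -> \bar R) :
  measurable_fun setT X -> measurable_fun setT Y ->
  (forall A B, measurable A -> measurable B ->
    Q (X @^-1` A `&` Y @^-1` B) = (Q (X @^-1` A) * nu B)%E) ->
  measurable_fun setT f -> (forall z, (0 <= f z)%E) ->
  (\int[Q]_t f (X t, Y t) = \int[Q]_t \int[nu]_y f (X t, y))%E.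
Proof.
move=> mX mY QE mf f0.
have mZ : measurable_fun setT (fun t => (X t, Y t)).
  exact: measurable_fun_pair.
pose m1f : {measure set T1 -> \bar R} := pushforward Q X.
have m1fin : fin_num_fun (m1f mX).
  move=> A mA; apply: (@fin_num_measure _ _ _ Q).
  by rewrite -[X in measurable X]setTI; exact: mX.
pose m1' : {measure set T1 -> \bar R} := m1f mX.
have m1sigma : sigma_finite setT m1'.
  by apply: fin_num_fun_sigma_finite; rewrite ?measure0.
pose H1 := isSFinite.Build _ _ _ _ (sfinite_measure_sigma_finite m1sigma).
pose H2 := isSigmaFinite.Build _ _ _ _ m1sigma.
pose m1 := HB.pack_for (SigmaFiniteMeasure.type T1 R) (Measure.sort m1') H1 H2.
pose m' : {measure set (T1 * T2) -> \bar R} :=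
  pushforward Q (fun t => (X t, Y t)).
(* Rectangles determine the product measure, so the law of the pair is the law of [X] times [nu];
   Tonelli then integrates [Y] out. *)
have m1m' : forall Z, measurable Z -> (m1 \x nu)%E Z = m' mZ Z.
  by apply: product_measure_unique => A B mA mB; exact: QE.
have := ge0_integral_pushforward mZ Q measurableT mf (fun z _ => f0 z).
rewrite preimage_setT /= => <-.
transitivity (\int[m1 \x nu]_z f z)%E.
  by apply: eq_measure_integral => Z mZ' _; exact/esym/m1m'.
rewrite fubini_tonelli1//.
have := ge0_integral_pushforward mX Q measurableT
  (measurable_fun_fubini_tonelli_F f mf f0).
rewrite preimage_setT /= => <-.
  by [].
by move=> x _; apply: integral_ge0.
Qed.

Section chain.
Context (d : measure_display) (T : measurableType d) (R : realType)
  (P : probability T R) (xi : nat -> {RV P >-> borel (Omega R)}).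

Local Notation state n x := (fun t => fn x (fun i : 'I_n => xi i t)).

Lemma measurable_xi (n : nat) : measurable_fun setT (fun t => set_val (xi n t)).
Proof.
exact: (measurableT_comp (@measurable_Omega_val R) (measurable_funPT (xi n))).
Qed.

Lemma measurable_fn (n : nat) (x : S01 R) :
  measurable_fun setT (state n x : T -> borel (S01 R)).
Proof.
elim: n => [|n IH] /=; first exact: measurable_cst.
under eq_fun do rewrite fstepE.
exact: (measurableT_comp (@measurable_step R)
  (measurable_fun_pair IH (measurable_xi n))).
Qed.

Hypothesis xi_uniform : forall i, uniform_on_Omega (xi i).
Hypothesis xi_indep : mutually_independent xi.

Let event (J : {fset nat}) (B : nat -> set (borel (Omega R))) : set T :=
  \bigcap_(i in [set` J]) xi i @^-1` B i.

Let measurable_event J B :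
  (forall i, i \in J -> measurable (B i)) -> measurable (event J B).
Proof.
move=> mB; apply: fin_bigcap_measurable => // i iJ.
by rewrite -[X in measurable X]setTI; apply: measurable_funPT => //; exact: mB.
Qed.

(* Restricting to an arbitrary event on the noises from index [n] on carries the
   independence of the next noise through the induction. *)
Lemma expectation_fn (n : nat) (x : S01 R) (h : S01 R -> R) (J : {fset nat})
    (B : nat -> set (borel (Omega R)))
    (mB : forall i, i \in J -> measurable (B i)) :
  test_fun h -> (forall i, i \in J -> (n <= i)%N) ->
  (\int[mrestr P (measurable_event mB)]_t (h (state n x t))%:E =
   (iter n (@transition R) h x)%:E * P (event J B))%E.
Proof.
elim: n h J B mB => [|n IH] h J B mB th nJ.
  rewrite /= integral_cst//; congr (_ * _)%E.
  exact: (congr1 P (setTI _)).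
rewrite iterSr; have th' := test_fun_transition th.
have [mh _] := th.
under eq_integral do rewrite /= fstepE.
pose f (z : borel (S01 R) * measurableTypeR R) : \bar R :=
  (h (mod1 (2^-1 * set_val z.1 + 17 / 30 + z.2)))%:E.
(* Under [P] restricted to the event, noise [n] is uniform and independent of the state; integrating
   it out turns [h] into [transition h]. *)
have := @integral_independent _ _ _ _ _ _ _ (mrestr P (measurable_event mB))
  (noise R) _ _ f (measurable_fn n x) (measurable_xi n).
rewrite /f /=; move=> ->.
- rewrite -IH//; last by move=> i /nJ /ltnW.
  apply: eq_integral => t _; rewrite /transition fineK//.
  by apply: integrable_fin_num => //; exact: integrable_mod1D.
- move=> A C mA mC.
  have pr J0 B0 (mB0 : forall i, i \in J0 -> measurable (B0 i)) :
      (forall i, i \in J0 -> (n <= i)%N) ->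
      mrestr P (measurable_event mB0) (state n x @^-1` A) =
      ((iter n (@transition R) \1_A x)%:E * P (event J0 B0))%E.
    move=> nJ0; rewrite -(IH _ _ _ mB0)//; last exact: test_fun_indic.
    rewrite -[LHS](congr1 _ (setIT _)) -integral_indic//.
    by rewrite -[X in measurable X]setTI; apply: measurable_fn.
  (* The condition [C] on noise [n] joins the event on the later noises. The induction hypothesis
     applies to the enlarged event, and independence factors its probability. *)
  pose B' i := if i == n then [set w : borel (Omega R) | C (set_val w)] else B i.
  pose J' := (n |` J)%fset.
  have nJ' : n \notin J by apply/negP => /nJ; rewrite ltnn.
  have B'B i : i \in J -> B' i = B i.
    by move=> iJ; rewrite /B'; case: eqP => // ein; rewrite -ein iJ in nJ'.
  have mB' i : i \in J' -> measurable (B' i).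
    rewrite /B'; case: eqP => [_ _|/eqP ni].
      by rewrite -[X in measurable X]setTI; exact: measurable_Omega_val.
    by rewrite in_fset1U (negbTE ni) => /mB.
  have eJ' : event J' B' = (fun t => set_val (xi n t)) @^-1` C `&` event J B.
    apply/seteqP; split => [t et|t [Ct et] i /=].
      split=> [|i /= iJ].
        by have := et n; rewrite /B' /= eqxx; apply; rewrite in_fset1U eqxx.
      by rewrite -(B'B _ iJ); apply: et; rewrite /= in_fset1U iJ orbT.
    rewrite in_fset1U => /predU1P[->|iJ]; first by rewrite /B' eqxx.
    by rewrite B'B//; exact: et.
  have PJ' : P (event J' B') = (noise R C * P (event J B))%E.
    rewrite (xi_indep mB') (xi_indep mB) big_fsetU1//=; congr (_ * _)%E.
      by rewrite -(xi_uniform n mC) /B' eqxx.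
    by apply: eq_fbigr => i iJ _; rewrite B'B.
  transitivity (mrestr P (measurable_event mB') (state n x @^-1` A)).
    by rewrite /mrestr eJ' setIA.
  rewrite !pr//; last 2 first.
  - by move=> i /nJ/ltnW.
  - by move=> i; rewrite in_fset1U => /predU1P[->//|/nJ/ltnW].
  by rewrite PJ' -muleA [(noise R C * _)%E]muleC.
- by apply/measurable_EFinP; exact: (measurableT_comp mh (@measurable_step R)).
- by move=> z; rewrite lee_fin test_fun_ge0.
Qed.

Lemma Kn_transition (n : nat) (x : S01 R) (A : set (borel (S01 R))) :
  measurable A -> Kn xi n x A = (iter n (@transition R) \1_A x)%:E.
Proof.
move=> mA.
(* With an empty index set the event is the whole space. *)
have mB (i : nat) : i \in (fset0 : {fset nat}) ->
  measurable ((fun=> set0) i : set (borel (Omega R))) by [].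
have := expectation_fn (n := n) x mB (test_fun_indic mA).
have eT : event fset0 (fun=> set0) = setT.
  by apply/seteqP; split => // t _ i; rewrite /= inE.
rewrite [in X in _ = (_ * P X)%E]eT probability_setT mule1 => <-//.
have mXA : measurable (state n x @^-1` A).
  by rewrite -[X in measurable X]setTI; apply: measurable_fn.
transitivity (mrestr P (measurable_event mB) (state n x @^-1` A)).
  rewrite /Kn /mrestr; congr (P _); apply/seteqP; split => [t At|t []//].
  by split=> // i; rewrite /= inE.
by rewrite -[LHS](congr1 _ (setIT _)) -integral_indic.
Qed.
End chain.

(** * Uniform limits of measures *)

Lemma uniform_limit_measure (d : measure_display) (T : measurableType d)
    (R : realType) (p : nat -> {measure set T -> \bar R})
    (q : nat -> set T -> R) (l : set T -> R) (e : nat -> R) :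
  (forall n A, measurable A -> p n A = (q n A)%:E) ->
  (forall n A, measurable A -> `|q n A - l A| <= e n) ->
  e n @[n --> \oo] --> 0 ->
  exists mu : {measure set T -> \bar R},
    forall A, measurable A -> mu A = (l A)%:E.
Proof.
move=> pq ql e0.
have cq A : measurable A -> q n A @[n --> \oo] --> l A.
  move=> mA; apply/cvgrPdist_le => eps eps0.
  move/cvgrPdist_le : e0 => /(_ _ eps0); apply: filterS => n.
  rewrite sub0r normrN => en; rewrite distrC (le_trans (ql n _ mA))//.
  exact: le_trans (ler_norm _) en.
have l_ge0 A : measurable A -> 0 <= l A.
  move=> mA; rewrite -(cvg_lim _ (cq A mA))//.
  apply: limr_ge; first by apply/cvg_ex; exists (l A); exact: cq.
  by apply: nearW => n; rewrite -lee_fin -pq.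
(* Outside the measurable sets [l] is arbitrary, hence the absolute value. *)
pose mu (A : set T) : \bar R := `|l A|%:E.
have muE A : measurable A -> mu A = (l A)%:E.
  by move=> mA; rewrite /mu ger0_norm// l_ge0.
have mu0 : mu set0 = 0%E.
  rewrite muE//; congr (_%:E).
  rewrite -(cvg_lim _ (cq set0 measurable0))//.
  rewrite (_ : (fun n => q n set0) = (fun=> 0)) ?lim_cst//.
  by apply/funext => n; apply/EFin_inj; rewrite -pq// measure0.
have mu_ge0 A : (0 <= mu A)%E by rewrite lee_fin.
have mu_sigma : semi_sigma_additive mu.
  move=> F mF tF mUF.
  (* Finite additivity passes to the limit, so the partial sums are [l (U n)]. As [e k] bounds the
     error for all sets at once, a fixed [k] with [e k < eps / 3] serves every [U n] and the full
     union; the last third is the countable additivity of [p k]. *)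
  pose U n := \big[setU/set0]_(0 <= i < n) F i.
  have mU n : measurable (U n) by exact: bigsetU_measurable.
  have pU k n : (\sum_(0 <= i < n) p k (F i) = p k (U n))%E.
    have := mU n; rewrite /U !big_mkord => mUn.
    by rewrite measure_semi_additive.
  have lU n : (\sum_(0 <= i < n) mu (F i) = (l (U n))%:E)%E.
    under eq_bigr do rewrite muE//.
    rewrite sumEFin; congr (_%:E).
    have <- := cvg_lim (@Rhausdorff R) (cq (U n) (mU n)).
    apply/esym/cvg_lim; first exact: Rhausdorff.
    rewrite (_ : (fun k => q k (U n)) = (fun k => \sum_(0 <= i < n) q k (F i))).
      by apply: cvg_big => [|i _]; [exact: add_continuous|exact: cq].
    apply/funext => k; apply/EFin_inj; rewrite -pq// -pU -sumEFin.
    by apply: eq_bigr => i _; rewrite pq.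
  under eq_fun do rewrite lU.
  rewrite muE//; apply/cvg_EFin; first exact: nearW.
  apply/cvgrPdist_lt => eps eps0 /=.
  have eps3 : 0 < eps / 3 by rewrite divr_gt0.
  have [k ek] : exists k, e k < eps / 3.
    move/cvgrPdist_lt : e0 => /(_ _ eps3)[k _ /(_ k (leqnn k))].
    by rewrite sub0r normrN => ek; exists k; exact: le_lt_trans (ler_norm _) ek.
  have := @measure_semi_sigma_additive _ _ _ (p k) _ mF tF mUF.
  under eq_fun do rewrite pU pq//.
  rewrite pq// => /fine_cvg/cvgrPdist_lt/(_ _ eps3); apply: filterS => n /= qn.
  have := ql k _ mUF; have := ql k _ (mU n).
  move: qn ek; rewrite !ltr_norml !ler_norml; lra.
pose M := isMeasure.Build _ _ _ mu mu0 mu_ge0 mu_sigma.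
by exists (HB.pack_for {measure set T -> \bar R} mu M) => A /muE.
Qed.

Lemma cauchy_rate_cvg (R : realType) (u e : nat -> R) :
  (forall n j, (n <= j)%N -> `|u n - u j| <= e n) ->
  e n @[n --> \oo] --> 0 -> cvgn u.
Proof.
move=> ue e0; apply/cauchy_cvgP/cauchy_exP => eps eps0.
move/cvgrPdist_lt : e0 => /(_ _ eps0)[k _ /(_ k (leqnn k))].
rewrite sub0r normrN => ek; exists (u k); exists k => // j /= kj.
exact: le_lt_trans (ue _ _ kj) (le_lt_trans (ler_norm _) ek).
Qed.

Lemma norm_limn_le (R : realType) (u : nat -> R) (a b : R) (n : nat) :
  cvgn u -> (forall j, (n <= j)%N -> `|a - u j| <= b) -> `|a - limn u| <= b.
Proof.
move=> cu ub.
have cau : `|a - u j| @[j --> \oo] --> `|a - limn u|.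
  by apply: cvg_norm; apply: cvgB => //; exact: cvg_cst.
rewrite -(cvg_lim (@Rhausdorff R) cau); apply: limr_le.
  by apply/cvg_ex; exists `|a - limn u|.
by exists n => // j /= nj; exact: ub.
Qed.

Unset Implicit Arguments.
Set Strict Implicit.

Theorem theorem4p1 (R : realType) (d : measure_display) (T : measurableType d)
    (P : probability T R) (xi : nat -> {RV P >-> borel (Omega R)})
    (xi_uniform : forall i, uniform_on_Omega (xi i))
    (xi_indep : mutually_independent xi) :
  exists (C rho : R) (mu : {measure set (borel (S01 R)) -> \bar R}),
    [/\ 0 < C,
        rho < 1 &
        forall (n : nat) (x : S01 R) (A : set (borel (S01 R))),
          (1 <= n)%N -> measurable A ->
          (`|Kn xi n x A - mu A| <= (C * rho ^+ n)%:E)%E].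
Proof.
have [C [rho [C0 rho0 rho1 ergodic]]] := transition_ergodic R.
(* The limit is taken along the chain started at 0; [ergodic] compares every other starting point
   with it. *)
pose q n (A : set (borel (S01 R))) := iter n (@transition R) \1_A (mod1 0).
have rate0 : C * rho ^+ n @[n --> \oo] --> (0 : R).
  by rewrite -(mulr0 C); apply: cvgMr; apply: cvg_expr; rewrite ger0_norm.
have cq A : measurable A -> cvgn (q ^~ A).
  move=> mA; apply: (cauchy_rate_cvg _ rate0) => n j nj.
  exact: (ergodic _ (test_fun_indic mA)).
have rate n (x : S01 R) (A : set (borel (S01 R))) : measurable A ->
    `|iter n (@transition R) \1_A x - limn (q ^~ A)| <= C * rho ^+ n.
  move=> mA; apply: (norm_limn_le (n := n) (cq _ mA)) => j nj.
  exact: (ergodic _ (test_fun_indic mA) n j x (mod1 0) nj).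
pose p n : {measure set (borel (S01 R)) -> \bar R} :=
  pushforward P (fun t => fn (mod1 0) (fun i : 'I_n => xi i t) : borel (S01 R)).
have [mu muE] := @uniform_limit_measure _ _ _
  (p (fun n => measurable_fn xi n (mod1 0))) q (fun A => limn (q ^~ A)) _
  (fun n A mA => Kn_transition xi_uniform xi_indep n (mod1 0) mA)
  (fun n A mA => rate n (mod1 0) A mA) rate0.
exists C, rho, mu; split=> // n x A _ mA.
by rewrite Kn_transition// muE// -EFinB lee_fin rate.
Qed.
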